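(* Let $0<T<\infty$ and let $\xi,\xi_n\in S_0([0,T])$. Let $\tau:[-a,b]\to\mathbb{R}$ and $\tau_n:[-a_n,b_n]\to\mathbb{R}$ be the hitting times for $\xi$ and $\xi_n$, respectively, and $\varphi:[-a,0]\to[0,b]$ and $\varphi_n:[-a_n,0]\to[0,b_n]$ their conformal weldings. If $a_n\to a$, $b_n\to b$ and $\tau_n\to\tau$ uniformly on any $[c,d]\subset(-a,b)$, then $\varphi_n\to\varphi$ uniformly on $[-d,0]$ for any $[-d,0]\subset(-a,0]$.
   Context: A driver is a continuous function $\xi:[0,T]\to\mathbb{R}$. The upwards Loewner flow of $\xi$ in the upper half plane $\mathbb{H}$ is the solution of $\partial_t h_t(z)=\frac{-2}{h_t(z)-\xi(t)}$, $h_0(z)=z$; for $z\in\mathbb{H}$ it exists on all of $[0,T]$. Hitting times: for $x\in\mathbb{R}\setminus\{\xi(0)\}$, let $x(t)=h_t(x;\xi)$ be the real solution of the same ODE started at $x$, and let $\tau(x;\xi):=\inf\{t\ge 0: \liminf_{s\nearrow t}|x(s)-\xi(s)|=0\}$ (with $t\in[0,T]$ and $\inf\emptyset=+\infty$); also $\tau(\xi(0);\xi)=0$. Simple-curve drivers: $S([0,T])$ is the set of continuous $\xi:[0,T]\to\mathbb{R}$ that generate a simple curve, i.e. there is an injective continuous $\gamma:[0,T]\to\mathbb{H}\cup\{\xi(T)\}$ with $\gamma(0)=\xi(T)$ and $\gamma((0,T])\subset\mathbb{H}$ such that $h_T$ maps $\mathbb{H}$ conformally onto $\mathbb{H}\setminus\gamma((0,T])$.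 $S_0([0,T])$ is the set of $\xi\in S([0,T])$ with $\xi(0)=0$. Conformal welding: for $\xi\in S_0([0,T])$, $T<\infty$, the hitting time function is finite exactly on a compact interval $[-a,b]$ with $-a<0<b$ (its domain), is continuous there, strictly decreasing on $[-a,0]$ and strictly increasing on $[0,b]$, with $\tau(-a)=\tau(b)=T$. With $\tau_-=\tau|_{[-a,0]}$, $\tau_+=\tau|_{[0,b]}$, the conformal welding of $\xi$ is the homeomorphism $\varphi=\tau_+^{-1}\circ\tau_-:[-a,0]\to[0,b]$, i.e. $\tau(x)=\tau(\varphi(x))$. *)

(* Defs.v *)
From HB Require Import structures.
From mathcomp Require Import all_boot all_order all_algebra.
From mathcomp Require Import complex.
From mathcomp Require Import all_classical all_reals all_analysis.

Set Implicit Arguments.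
Unset Strict Implicit.
Unset Printing Implicit Defensive.

Import Order.TTheory GRing.Theory Num.Theory.
Import numFieldNormedType.Exports.

Local Open Scope classical_set_scope.
Local Open Scope ring_scope.

(* R[i] behind the numClosedFieldType interface: the topology and the normed
   module structure of MathComp-Analysis are attached to numFieldType, and are
   not found on the bare type R[i]. *)
Definition Cplx (R : realType) : numClosedFieldType := R[i].

Definition cre (R : realType) (z : Cplx R) : R := complex.Re (z : R[i]).
Definition cim (R : realType) (z : Cplx R) : R := complex.Im (z : R[i]).
Definition cofR (R : realType) (x : R) : Cplx R := (x%:C)%C.

Definition upper_half_plane (R : realType) : set (Cplx R) :=
  [set z | 0 < cim z].

(* Only the values of xi on [0, T] are ever used. *)
Definition driver (R : realType) (T : R) (xi : R -> R) : Prop :=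
  {within `[0, T], continuous xi}.

(* x solves x' = -2 / (x - xi) on [0, t) with x(0) = x0. The ODE is imposed on
   (0, t); with continuity on [0, t) it then also holds at 0, one-sidedly.
   Since 0^-1 = 0 in MathComp, x <> xi has to be required separately. *)
Definition real_loewner_sol (R : realType) (xi : R -> R) (x0 t : R)
    (x : R -> R) : Prop :=
  [/\ x 0 = x0,
      {within `[0, t[, continuous x},
      (forall s, 0 <= s < t -> x s != xi s) &
      (forall s, 0 < s < t -> is_derive s 1 x (- 2 / (x s - xi s)))].

(* Hitting time, +oo if there is none in [0, T]. The solution of the real ODE
   being unique, any solution on [0, t) is the restriction of the maximal one;
   for x0 <> xi(0) the time t = 0 is never a hitting time. *)
Definition hitting_time (R : realType) (T : R) (xi : R -> R) (x0 : R) : \bar R :=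
  if x0 == xi 0 then 0%E else
  ereal_inf [set t%:E | t in
    [set t : R | 0 < t <= T /\ exists x : R -> R,
      real_loewner_sol xi x0 t x /\
      limf_einf (fun s => `|x s - xi s|%:E) t^'- = 0%E]].

(* t |-> h t z solves the upwards Loewner equation on [0, T] for z in the upper
   half plane; the time derivative is taken on real and imaginary parts. *)
Definition upward_loewner_flow (R : realType) (T : R) (xi : R -> R)
    (h : R -> Cplx R -> Cplx R) : Prop :=
  forall z, upper_half_plane z ->
    [/\ h 0 z = z,
        (forall t, 0 <= t <= T -> upper_half_plane (h t z)),
        {within `[0, T], continuous (fun t => h t z)} &
        (forall t, 0 < t < T ->
          let v : Cplx R := - 2 / (h t z - cofR (xi t)) in
          is_derive t 1 (fun s => cre (h s z)) (cre v) /\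
          is_derive t 1 (fun s => cim (h s z)) (cim v))].

Definition conformal_onto (R : realType) (f : Cplx R -> Cplx R)
    (A B : set (Cplx R)) : Prop :=
  (forall z, A z -> derivable f z 1) /\ set_bij A B f.

Definition simple_curve_driver (R : realType) (T : R) (xi : R -> R) : Prop :=
  driver T xi /\
  exists (h : R -> Cplx R -> Cplx R) (gamma : R -> Cplx R),
    [/\ upward_loewner_flow T xi h,
        {within `[0, T], continuous gamma},
        {in `[0, T] &, injective gamma},
        gamma 0 = cofR (xi T) /\
          gamma @` `]0, T] `<=` @upper_half_plane R &
        conformal_onto (h T) (@upper_half_plane R)
          (@upper_half_plane R `\` gamma @` `]0, T])].

Definition simple_curve_driver0 (R : realType) (T : R) (xi : R -> R) : Prop :=
  simple_curve_driver T xi /\ xi 0 = 0.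

(* tau : [-a, b] -> R is the hitting time function of xi restricted to the
   interval [-a, b] on which it is finite. *)
Definition hitting_times (R : realType) (T : R) (xi : R -> R) (a b : R)
    (tau : R -> R) : Prop :=
  [/\ - a < 0, 0 < b,
      (forall x, - a <= x <= b -> hitting_time T xi x = (tau x)%:E) &
      (forall x, ~~ (- a <= x <= b) -> hitting_time T xi x = +oo%E)].

(* phi = tau_+^-1 o tau_- : [-a, 0] -> [0, b]. As tau is injective on [0, b],
   these conditions determine phi on [-a, 0]. *)
Definition conformal_welding (R : realType) (a b : R) (tau phi : R -> R) : Prop :=
  forall x, - a <= x <= 0 -> 0 <= phi x <= b /\ tau (phi x) = tau x.

(* Main.v *)
Require Import Defs.
From mathcomp Require Import all_boot all_order all_algebra.
From mathcomp Require Import ring lra.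
From mathcomp Require Import all_classical all_reals all_analysis.

Import Order.TTheory GRing.Theory Num.Theory.
Import numFieldNormedType.Exports.

Local Open Scope classical_set_scope.
Local Open Scope ring_scope.

Set Implicit Arguments.
Unset Strict Implicit.

(** The theorem combines a fact about the flow with a fact about monotone
    functions.

    Flow.  Let [x] and [y] solve the real Loewner equation to the right of the
    driver [xi], with [x 0 < y 0].  Since
      (y - x)' = 2 (y - x) / ((x - xi) (y - xi)),
    the square [(y - x)^2] is nondecreasing.  The two solutions therefore never
    meet, and [y] stays at distance at least [y 0 - x 0] from the driver for as
    long as [x] lives ([real_loewner_sol_gap]).  So [x] is hit strictly before
    [y] ([loewner_hit_lt]): the hitting time function is strictly increasing to
    the right of [xi 0] ([hitting_times_increasing]).  The reflection
    [z |-> - z] of the real line gives the left side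
    ([hitting_times_decreasing]).

    Monotone functions.  By strict monotonicity, [tau] grows by at least some
    [delta > 0] between any two points of [[0, b]] at distance at least [e]
    ([uniform_increase]): a finite grid does the work of compactness.  For [x]
    in [[- d, 0]], [phi x] is at most [phi (- d) < b]
    ([conformal_welding_decreasing]), so it stays where the [tau_ n] converge
    uniformly.  If [phi_ n x] were at distance [e] or more
    from [phi x], monotonicity of [tau_ n] would make
    [tau_ n x = tau_ n (phi_ n x)] differ from [tau x = tau (phi x)] by at least
    [delta] up to the uniform error, which tends to 0. *)

(** * Two solutions of the real Loewner equation *)

Lemma pos_of_nonvanishing {R : realType} (t : R) (f : R -> R) :
  {within `[0, t[, continuous f} -> (forall s, 0 <= s < t -> f s != 0) ->
  0 < f 0 -> forall s, 0 <= s < t -> 0 < f s.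
Proof.
move=> fc f_neq0 f0_gt0 s /andP[s_ge0 s_lt].
rewrite ltNge; apply/negP => fs_le0.
have fc' : {within `[0, s], continuous f}.
  apply: continuous_subspaceW fc => r /=; rewrite !in_itv/= => /andP[-> rs] /=.
  exact: le_lt_trans rs s_lt.
have [|r] := IVT s_ge0 fc' (v := 0).
  by rewrite ge_min fs_le0 orbT le_max (ltW f0_gt0).
rewrite in_itv/= => /andP[r_ge0 rs] fr0.
by have := f_neq0 r; rewrite fr0 eqxx r_ge0 (le_lt_trans rs s_lt) => /(_ isT).
Qed.

(** The right-hand side is singular on the driver, so a solution keeps to one
    side of it; there the flow spreads points apart, and [y - x] never falls
    below its initial value. *)
Lemma real_loewner_sol_gap {R : realType} (xi : R -> R) (t x0 y0 : R)
    (x y : R -> R) :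
  {within `[0, t[, continuous xi} ->
  real_loewner_sol xi x0 t x -> real_loewner_sol xi y0 t y ->
  xi 0 < x0 -> x0 < y0 ->
  forall s, 0 <= s < t -> xi s + (y0 - x0) <= y s.
Proof.
move=> xic [x0E xc x_neq x'] [y0E yc y_neq y'] x0_gt y0_gt.
have x_gt s : 0 <= s < t -> 0 < x s - xi s.
  apply: (@pos_of_nonvanishing _ t (x - xi)) => [|r rt|].
  - exact: within_continuousB.
  - by rewrite subr_eq0; exact: x_neq.
  - by rewrite !fctE x0E subr_gt0.
have y_gt s : 0 <= s < t -> 0 < y s - xi s.
  apply: (@pos_of_nonvanishing _ t (y - xi)) => [|r rt|].
  - exact: within_continuousB.
  - by rewrite subr_eq0; exact: y_neq.
  - by rewrite !fctE y0E subr_gt0 (lt_trans x0_gt).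
have yxc : {within `[0, t[, continuous (y - x)} by exact: within_continuousB.
(* The derivative of the square of y - x has a sign that does not depend on the
   sign of y - x, which is not known yet. *)
have sq_le s : 0 <= s < t -> (y0 - x0) ^+ 2 <= (y s - x s) ^+ 2.
  move=> /andP[s_ge0 st].
  pose v r := - 2 / (y r - xi r) - - 2 / (x r - xi r).
  have [||r] := @MVT_segment _ ((y - x) * (y - x))
      (fun r => 2 * (y r - x r) * v r) 0 s s_ge0.
  - move=> r; rewrite in_itv/= => /andP[r_gt0 rs].
    have r0t : 0 < r < t by rewrite r_gt0 (lt_trans rs).
    have dy := y' _ r0t; have dx := x' _ r0t.
    apply: is_derive_eq; rewrite /v /GRing.scale/= !fctE; ring.
  - have sub : `[0, s] `<=` `[0, t[.
      move=> r /=; rewrite !in_itv/= => /andP[-> rs] /=.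
      exact: le_lt_trans rs st.
    move=> r; apply: (@continuousM _ (subspace `[0, s]));
      exact: continuous_subspaceW yxc r.
  rewrite in_itv/= => /andP[r_ge0 rs].
  have r0t : 0 <= r < t by rewrite r_ge0 (le_lt_trans rs).
  rewrite !fctE x0E y0E subr0 -!expr2 => eqf.
  rewrite -subr_ge0 eqf mulr_ge0//.
  have X := x_gt _ r0t; have Y := y_gt _ r0t.
  have -> : 2 * (y r - x r) * v r =
      4 * (y r - x r) ^+ 2 / ((y r - xi r) * (x r - xi r)).
    by rewrite /v; field; rewrite !gt_eqF.
  apply: divr_ge0; first by rewrite mulr_ge0 ?sqr_ge0.
  by rewrite mulr_ge0 ?(ltW X) ?(ltW Y).
have yx_gt s : 0 <= s < t -> 0 < y s - x s.
  apply: (@pos_of_nonvanishing _ t (y - x)) => [//|r rt|].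
  - rewrite -sqrf_eq0 gt_eqF// (lt_le_trans _ (sq_le _ rt))//.
    by rewrite exprn_gt0// subr_gt0.
  - by rewrite !fctE x0E y0E subr_gt0.
move=> s st; have := sq_le _ st; have X := x_gt _ st; have D := yx_gt _ st.
rewrite ler_pXn2r ?nnegrE ?(ltW D) ?subr_ge0 ?(ltW y0_gt)//; lra.
Qed.

(** * Monotonicity of the hitting time *)

Definition loewner_hit {R : realType} (T : R) (xi : R -> R) (x0 : R) : set R :=
  [set t : R | 0 < t <= T /\ exists x : R -> R,
    real_loewner_sol xi x0 t x /\
    limf_einf (fun s => `|x s - xi s|%:E) t^'- = 0%E].

Lemma hitting_timeE {R : realType} (T : R) (xi : R -> R) (x0 : R) :
  x0 != xi 0 ->
  hitting_time T xi x0 = ereal_inf [set t%:E | t in loewner_hit T xi x0].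
Proof. by rewrite /hitting_time => /negPf ->. Qed.

Lemma limf_einf_left_ge {R : realType} (f : R -> R) (t c : R) : 0 < t ->
  (forall s, 0 < s < t -> c <= f s) ->
  (c%:E <= limf_einf (fun s => (f s)%:E) t^'-)%E.
Proof.
move=> t_gt0 fc; rewrite limf_einfE.
apply: (@le_trans _ _ (ereal_inf [set (f s)%:E | s in `]0, t[])).
  apply: le_ereal_inf_tmp => _ [s st <-].
  by rewrite lee_fin fc//; move: st; rewrite /= in_itv.
apply: ereal_sup_ubound; exists `]0, t[%classic => //.
near=> s; rewrite /= in_itv/=; apply/andP; split; near: s.
- exact: nbhs_left_gt.
- exact: nbhs_left_lt.
Unshelve. all: by end_near. Qed.

(** If [y] were hit at a time at which [x] is still alive, [y] would at once be
    close to the driver and above it by at least [y0 - x0]. *)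
Lemma loewner_hit_lt {R : realType} (T : R) (xi : R -> R) (x0 y0 s t : R) :
  driver T xi -> xi 0 < x0 -> x0 < y0 ->
  loewner_hit T xi x0 s -> loewner_hit T xi y0 t -> s < t.
Proof.
move=> xic x0_gt y0_gt [/andP[s_gt0 sT] [x [xsol _]]].
move=> [/andP[t_gt0 tT] [y [ysol y_hit]]].
rewrite ltNge; apply/negP => ts.
have sub : `[0, t[ `<=` `[0, s[.
  by move=> r /=; rewrite !in_itv/= => /andP[-> rt]; exact: lt_le_trans rt ts.
have xsol' : real_loewner_sol xi x0 t x.
  case: xsol => x0E xc x_neq x'; split => //.
  - exact: continuous_subspaceW xc.
  - by move=> r /andP[r_ge0 rt]; apply: x_neq; rewrite r_ge0 (lt_le_trans rt).
  - by move=> r /andP[r_ge0 rt]; apply: x'; rewrite r_ge0 (lt_le_trans rt).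
have xict : {within `[0, t[, continuous xi}.
  apply: continuous_subspaceW xic => r /=; rewrite !in_itv/= => /andP[-> rt].
  by rewrite (ltW (lt_le_trans rt tT)).
have gap := real_loewner_sol_gap xict xsol' ysol x0_gt y0_gt.
have : ((y0 - x0)%:E <= 0)%E.
  rewrite -y_hit; apply: limf_einf_left_ge => // r /andP[r_gt0 rt].
  rewrite (le_trans _ (ler_norm _))// lerBrDl gap// rt ltW//.
by rewrite lee_fin leNgt subr_gt0 y0_gt.
Qed.

Lemma loewner_hitN {R : realType} (T : R) (xi : R -> R) (x0 t : R) :
  loewner_hit T xi x0 t -> loewner_hit T (- xi) (- x0) t.
Proof.
move=> [tT [x [[x0E xc x_neq x'] x_hit]]]; split=> //; exists (- x); split.
  split.
  - by rewrite fctE x0E.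
  - by move=> r; apply: (@continuousN _ _ (subspace `[0, t[)); exact: xc.
  - by move=> s st; rewrite !fctE eqr_opp; exact: x_neq.
  - move=> s st; have dx := x' _ st.
    apply: is_derive_eq; rewrite !fctE -opprD invrN; ring.
rewrite -x_hit; congr (limf_einf _ _); apply/funext => s /=.
by rewrite !fctE -opprD normrN.
Qed.

Lemma hitting_timeN {R : realType} (T : R) (xi : R -> R) (x0 : R) :
  hitting_time T (- xi) (- x0) = hitting_time T xi x0.
Proof.
rewrite /hitting_time fctE eqr_opp; case: ifP => // _.
congr (ereal_inf (_ @` _)); apply/seteqP; split=> t; last exact: loewner_hitN.
by move/loewner_hitN; rewrite !opprK.
Qed.

Lemma hitting_timesN {R : realType} (T : R) (xi : R -> R) (a b : R)
    (tau : R -> R) :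
  hitting_times T xi a b tau -> hitting_times T (- xi) b a (tau \o -%R).
Proof.
have flip x : (- b <= x <= a) = (- a <= - x <= b) by lra.
move=> [a_gt0 b_gt0 tauE tauy]; split; [lra | lra | |] => x.
- by rewrite flip -[x in hitting_time _ _ x]opprK hitting_timeN; exact: tauE.
- by rewrite flip -[x in hitting_time _ _ x]opprK hitting_timeN; exact: tauy.
Qed.

(** A hitting time is an infimum of times, so the comparison of the points [x]
    and [y] gives a weak inequality only.  A hit of the midpoint [z] is a time
    that separates the two infima strictly; it also covers the case
    [x = xi 0], where the hitting time is 0 by convention. *)
Lemma hitting_times_increasing {R : realType} (T : R) (xi : R -> R) (a b : R)
    (tau : R -> R) : driver T xi -> hitting_times T xi a b tau ->
  forall x y, - a <= x -> xi 0 <= x -> x < y -> y <= b -> tau x < tau y.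
Proof.
move=> xic [a_gt0 b_gt0 tauE _] x y ax x_ge xy yb.
have hit z : xi 0 < z -> - a <= z <= b ->
    ereal_inf [set t%:E | t in loewner_hit T xi z] = (tau z)%:E.
  by move=> z_gt zab; rewrite -hitting_timeE ?gt_eqF// tauE.
have hit_ex z : xi 0 < z -> - a <= z <= b -> exists u, loewner_hit T xi z u.
  move=> z_gt zab; apply/set0P/negP => /eqP h0.
  by have := hit _ z_gt zab; rewrite h0 image_set0 ereal_inf0.
have tau_le z u : xi 0 < z -> - a <= z <= b -> loewner_hit T xi z u ->
    tau z <= u.
  move=> z_gt zab zu; rewrite -lee_fin -hit//.
  by apply: ereal_inf_lbound; exists u.
have le_tau z c : xi 0 < z -> - a <= z <= b ->
    (forall u, loewner_hit T xi z u -> c <= u) -> c <= tau z.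
  move=> z_gt zab zc; rewrite -lee_fin -hit//.
  by apply: le_ereal_inf_tmp => _ [u zu <-]; rewrite lee_fin zc.
pose z := (x + y) / 2.
have [xz zy] : x < z /\ z < y by rewrite /z; split; lra.
have z_gt : xi 0 < z by lra.
have zab : - a <= z <= b by lra.
have [u zu] := hit_ex _ z_gt zab.
have u_le : u <= tau y.
  apply: le_tau => [||v yv]; [lra | lra |].
  exact/ltW/(loewner_hit_lt xic z_gt zy zu yv).
apply: lt_le_trans u_le.
have [x_eq|x_gt] := eqVneq x (xi 0).
  have -> : tau x = 0.
    apply: EFin_inj; rewrite -tauE; last by lra.
    by rewrite /hitting_time x_eq eqxx.
  by case: zu => /andP[].
have {}x_gt : xi 0 < x by rewrite lt_neqAle eq_sym x_gt.
have xab : - a <= x <= b by lra.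
have [v xv] := hit_ex _ x_gt xab.
apply: le_lt_trans (loewner_hit_lt xic x_gt xz xv zu).
exact: tau_le.
Qed.

Lemma hitting_times_decreasing {R : realType} (T : R) (xi : R -> R) (a b : R)
    (tau : R -> R) : driver T xi -> hitting_times T xi a b tau ->
  forall x y, - a <= x -> x < y -> y <= xi 0 -> y <= b -> tau y < tau x.
Proof.
move=> xic /hitting_timesN htau x y ax xy y_le yb.
have xicN : driver T (- xi).
  by move=> r; apply: (@continuousN _ _ (subspace `[0, T])); exact: xic.
have := @hitting_times_increasing _ _ _ _ _ _ xicN htau (- y) (- x).
rewrite /= !opprK; apply; rewrite ?lerN2 ?ltrN2//; lra.
Qed.

(** * Monotone functions and uniform convergence *)

Lemma conformal_welding_decreasing {R : realType} (a b : R) (tau phi : R -> R) :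
  (forall x y, 0 <= x -> x < y -> y <= b -> tau x < tau y) ->
  (forall x y, - a <= x -> x < y -> y <= 0 -> tau y < tau x) ->
  conformal_welding a b tau phi ->
  forall x y, - a <= x -> x < y -> y <= 0 -> phi y < phi x.
Proof.
move=> tau_incr tau_decr hphi x y ax xy y_le0.
have xa : - a <= x <= 0 by lra.
have ya : - a <= y <= 0 by lra.
have [/andP[px_ge0 px_le] tau_px] := hphi _ xa.
have [/andP[py_ge0 py_le] tau_py] := hphi _ ya.
have := tau_decr _ _ ax xy y_le0; rewrite -tau_px -tau_py => tau_lt.
rewrite ltNge le_eqVlt; apply/negP => /predU1P[pE|p_lt].
  by rewrite pE ltxx in tau_lt.
by have := tau_incr _ _ px_ge0 p_lt py_le; rewrite ltNge (ltW tau_lt).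
Qed.

(** Cut [[c, B]] by a grid of step [e / 2]: two points at distance at least [e]
    have a whole cell of the grid between them, and there are finitely many
    cells, each with a positive increase of [f]. *)
Lemma uniform_increase {R : realType} (f : R -> R) (c B e : R) : 0 < e ->
  (forall x y, c <= x -> x < y -> y <= B -> f x < f y) ->
  exists2 delta, 0 < delta &
    forall x y, c <= x -> x + e <= y -> y <= B -> f x + delta <= f y.
Proof.
move=> e_gt0 f_incr; pose h := e / 2.
have h_gt0 : 0 < h by rewrite /h; lra.
have main n : exists2 delta, 0 < delta & forall x y,
    c <= x -> x + e <= y -> y <= B -> x < c + n%:R * h -> f x + delta <= f y.
  elim: n => [|n [delta delta_gt0 IH]].
    by exists 1 => // x y cx _ _; rewrite mul0r; lra.
  (* The new points x lie in the cell that ends at p; the next cell, up to q,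
     separates them from y. *)
  pose p := c + n.+1%:R * h; pose q := p + h.
  have nE : c + n%:R * h = p - h by rewrite /p -natr1; ring.
  have cp : c <= p by rewrite /p lerDl mulr_ge0// ltW.
  have [qB|Bq] := leP q B; last first.
    exists delta => // x y cx xy yB x_lt; apply: IH => //; rewrite nE.
    move: Bq; rewrite /q /h; lra.
  have pq : f p < f q by apply: f_incr => //; rewrite /q; lra.
  have mono x y : c <= x -> x <= y -> y <= B -> f x <= f y.
    by move=> cx; rewrite le_eqVlt => /predU1P[->//|xy yB]; exact/ltW/f_incr.
  exists (Num.min delta (f q - f p)).
    by rewrite lt_min delta_gt0 subr_gt0.
  move=> x y cx xy yB x_lt; have [xn|nx] := ltP x (c + n%:R * h).
    by rewrite (le_trans _ (IH _ _ cx xy yB xn))// lerD2l ge_min lexx.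
  have fxp : f x <= f p.
    by apply: mono; rewrite -/p in x_lt; rewrite /q in qB; lra.
  have fqy : f q <= f y.
    by apply: mono => //; move: nx; rewrite nE /q /h; lra.
  have : Num.min delta (f q - f p) <= f q - f p by rewrite ge_min lexx orbT.
  lra.
have [delta delta_gt0 incr] := main (Num.truncn ((B - c) / h)).+1.
exists delta => // x y cx xy yB; apply: incr => //.
rewrite -ltrBlDl -ltr_pdivrMr// (le_lt_trans _ (truncnS_gt _))//.
by rewrite ler_pM2r ?invr_gt0//; lra.
Qed.

Lemma cvg_uniform_seqP {R : realType} (A : set R) (f_ : nat -> R -> R)
    (f : R -> R) :
  {uniform A, f_ @ \oo --> f} <->
  forall e, 0 < e -> \forall n \near \oo, forall x, A x -> `|f x - f_ n x| < e.
Proof.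
split=> [ff e e_gt0|ff P /uniform_nbhs[E [+ EP]]].
  have : nbhs (f : {uniform` A -> R})
      [set h | forall x, A x -> `|f x - h x| < e].
    apply/uniform_nbhs; exists [set xy | ball xy.1 e xy.2]; split=> //.
    exact: entourage_ball (PosNum e_gt0).
  exact: ff.
rewrite -entourage_ballE => -[e /= e_gt0 eE].
apply: filterS (ff e e_gt0) => n fn; apply: EP => x Ax.
by apply: eE => /=; exact: fn.
Qed.

Unset Implicit Arguments.

(** * Convergence of the weldings *)

Theorem lemma4p1 (R : realType) (T : R) (xi : R -> R) (xi_ : nat -> R -> R)
    (a b : R) (a_ b_ : nat -> R)
    (tau : R -> R) (tau_ : nat -> R -> R)
    (phi : R -> R) (phi_ : nat -> R -> R) :
  0 < T ->
  simple_curve_driver0 T xi ->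
  (forall n, simple_curve_driver0 T (xi_ n)) ->
  hitting_times T xi a b tau ->
  (forall n, hitting_times T (xi_ n) (a_ n) (b_ n) (tau_ n)) ->
  conformal_welding a b tau phi ->
  (forall n, conformal_welding (a_ n) (b_ n) (tau_ n) (phi_ n)) ->
  a_ @ \oo --> a ->
  b_ @ \oo --> b ->
  (forall c d : R, - a < c -> d < b ->
    {uniform `[c, d], tau_ @ \oo --> tau}) ->
  forall d : R, - a < - d -> {uniform `[- d, 0], phi_ @ \oo --> phi}.
Proof.
move=> _ [[xic _] xi0] xi_n htau htau_ hphi hphi_ a_cvg b_cvg tau_cvg d ad.
have [a_gt0 b_gt0 _ _] := htau.
have tau_incr x y : 0 <= x -> x < y -> y <= b -> tau x < tau y.
  move=> x_ge0 xy yb.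
  have := @hitting_times_increasing _ _ _ _ _ _ xic htau x y.
  by rewrite xi0; apply => //; lra.
have tau_decr x y : - a <= x -> x < y -> y <= 0 -> tau y < tau x.
  move=> ax xy y_le0.
  have := @hitting_times_decreasing _ _ _ _ _ _ xic htau x y.
  by rewrite xi0; apply => //; lra.
have tau_n_nd n x y : 0 <= x -> x <= y -> y <= b_ n -> tau_ n x <= tau_ n y.
  move=> x_ge0; rewrite le_eqVlt => /predU1P[->//|xy yb].
  have [[xic_n _] xi0_n] := xi_n n; have [an_gt0 _ _ _] := htau_ n.
  apply/ltW/(@hitting_times_increasing _ _ _ _ _ _ xic_n (htau_ n)) => //; lra.
have [d_lt0|d_ge0] := ltP d 0.
  apply/cvg_uniform_seqP => e e_gt0; near=> n => x /=.
  by rewrite in_itv/=; lra.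
have phi_decr := conformal_welding_decreasing tau_incr tau_decr hphi.
have pd_lt : phi (- d) < b.
  have aa : - a <= - a <= 0 by lra.
  have [/andP[_ pa_le] _] := hphi _ aa.
  by apply: lt_le_trans pa_le; apply: phi_decr; lra.
have phi_le x : - d <= x -> x <= 0 -> phi x <= phi (- d).
  rewrite le_eqVlt => /predU1P[->//|dx x_le0].
  by apply/ltW/phi_decr => //; lra.
apply/cvg_uniform_seqP => e0 e0_gt0.
(* Shrinking e0 keeps phi x + e in a compact subset of [0, b[. *)
pose e := Num.min e0 ((b - phi (- d)) / 2).
have e_gt0 : 0 < e by rewrite /e lt_min e0_gt0/=; lra.
have e_le0 : e <= e0 by rewrite /e ge_min lexx.
have e_leb : e <= (b - phi (- d)) / 2 by rewrite /e ge_min lexx orbT.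
have [delta delta_gt0 gap] := @uniform_increase _ tau 0 b e e_gt0 tau_incr.
have topb : phi (- d) + e < b by lra.
have delta3 : 0 < delta / 3 by lra.
have tau_close := (cvg_uniform_seqP _ _ _).1 (tau_cvg _ _ ad topb) _ delta3.
near=> n => x; rewrite /= in_itv/= => /andP[dx x_le0].
have xa : - a <= x <= 0 by lra.
have d_le_an : d < a_ n by near: n; apply: (cvgr_gt a) => //; lra.
have top_le_bn : phi (- d) + e < b_ n by near: n; exact: (cvgr_gt b).
have xan : - a_ n <= x <= 0 by lra.
have close : forall z, - d <= z -> z <= phi (- d) + e ->
    `|tau z - tau_ n z| < delta / 3.
  move=> z dz zt; suff: forall z, `[- d, phi (- d) + e]%classic z ->
    `|tau z - tau_ n z| < delta / 3 by apply; rewrite /= in_itv/= dz.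
  by near: n; exact: tau_close.
have [/andP[px_ge0 px_le] tau_px] := hphi _ xa.
have [/andP[pn_ge0 pn_le] tau_pn] := hphi_ n _ xan.
have px_le_pd := phi_le _ dx x_le0.
have close_x : `|tau x - tau_ n x| < delta / 3 by apply: close; lra.
apply: (lt_le_trans _ e_le0); rewrite ltr_norml; apply/andP.
split; rewrite ltNge; apply/negP => far.
- pose z := phi x + e.
  have zn : tau_ n z <= tau_ n (phi_ n x).
    by apply: tau_n_nd => //; rewrite /z; lra.
  have zx : tau (phi x) + delta <= tau z by apply: gap => //; rewrite /z; lra.
  have close_z : `|tau z - tau_ n z| < delta / 3.
    by apply: close; rewrite /z; lra.
  move: zn zx close_z close_x; rewrite tau_pn tau_px !ltr_norml; lra.
- pose z := phi x - e.
  have zn : tau_ n (phi_ n x) <= tau_ n z.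
    by apply: tau_n_nd => //; rewrite /z; lra.
  have zx : tau z + delta <= tau (phi x) by apply: gap => //; rewrite /z; lra.
  have close_z : `|tau z - tau_ n z| < delta / 3.
    by apply: close; rewrite /z; lra.
  move: zn zx close_z close_x; rewrite tau_pn tau_px !ltr_norml; lra.
Unshelve. all: by end_near. Qed.
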